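(* Let $h\colon\mathbb{N}_2\to\mathbb{C}$ be a convex light weight. Suppose that $B_h(1)_1$ and $C_h(1)_1$ exist. Then $B_h(1)_1\ne0$ and $$\lim_{n\to\infty}a_n^h=1-\frac{1}{B_h(1)_1}.$$
   Context: $\mathbb{N}=\{1,2,\dots\}$, $\mathbb{N}_0=\{0,1,2,\dots\}$, and $\mathbb{N}_2=\{e\subset\mathbb{N}:|e|=2\}$. A weight is a map $h\colon\mathbb{N}_2\to\mathbb{C}$. A walk of length $n\in\mathbb{N}_0$ is a tuple $w=\langle v_0,\dots,v_n\rangle$ of elements of $\mathbb{N}$ with $v_{i-1}\ne v_i$ for $i=1,\dots,n$; its weight is $h(w)=\prod_{i=1}^n h(\{v_{i-1},v_i\})$ (and $h(w)=1$ if $n=0$). A series $\sum_{x\in X}g(x)$ over an at most countable set $X$ converges absolutely if the sums $\sum_{x\in Y}|g(x)|$ over finite $Y\subset X$ are bounded; then its sum is independent of the order of summation. For a set $W$ of walks, $h(W)$ denotes the sum of $\sum_{w\in W}h(w)$ when it converges absolutely. $W(n)$ is the set of walks of length $n$ with $v_0=1$. The weight $h$ is light if $\sum_{w\in W(n)}h(w)$ converges absolutely for every $n\in\mathbb{N}_0$. $V(h)$ is the set of vertices $u\in\mathbb{N}$ such that some walk starting at $1$ and ending at $u$ has nonzero weight (so $1\in V(h)$). A light weight $h$ is convex if for every $u\in V(h)$, $\sum_{v\in\mathbb{N}\setminus\{u\}}h(\{u,v\})=1$ (this series converges absolutely for light $h$). Define $a_n^h=h(W(1,n))$, where $W(1,n)$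 is the set of walks in $W(n)$ with $v_i=1$ for some $i\in\{1,\dots,n\}$; $B_h(x)=\sum_{n\ge0}b_n^hx^n$ with $b_n^h=h(W_b(n))$, where $W_b(n)$ is the set of walks of length $n$ with $v_0=v_n=1$; $C_h(x)=\sum_{n\ge0}c_n^hx^n$ with $c_n^h=h(W_c(n))$, where $W_c(0)=\emptyset$ and for $n\ge1$, $W_c(n)$ is the set of walks of length $n$ with $v_0=v_n=1$ and $v_i\ne1$ for $0<i<n$. For $U(x)=\sum_{n\ge0}u_nx^n\in\mathbb{C}[[x]]$, we say $U(1)_1$ exists if $\lim_{n\to\infty}\sum_{j=0}^nu_j$ exists in $\mathbb{C}$, and $U(1)_1$ denotes this limit. *)

(* Defs.v *)
From HB Require Import structures.
From mathcomp Require Import all_boot all_order all_algebra finmap.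
From mathcomp Require Import complex.
From mathcomp Require Import all_classical all_reals all_analysis.

Set Implicit Arguments.
Unset Strict Implicit.
Unset Printing Implicit Defensive.

Import Order.TTheory GRing.Theory Num.Theory.
Import numFieldNormedType.Exports.

Local Open Scope classical_set_scope.
Local Open Scope ring_scope.
Local Open Scope complex_scope.

(* The usual norm topology of the complex numbers: the library attaches it to
   K^o for a numFieldType K, so it has to be transferred to R[i]. *)
HB.instance Definition _ (R : realType) := NormedModule.copy R[i] R[i]^o.

(* The index set of a series is a subset of an arbitrary choiceType: the walks
   and vertices summed over below range over countable types anyway. *)
Definition abs_summable (R : realType) (T : choiceType) (X : set T)
    (g : T -> R[i]) : Prop :=
  exists M : R, forall Y : set T, fsets X Y -> \sum_(x \in Y) `|g x| <= M%:C.

(* The directed set of finite subsets of X, ordered by inclusion. *)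
Definition fsets_filter (T : choiceType) (X : set T) : set_system (set T) :=
  filter_from (fsets X) (fun A => [set B | fsets X B /\ A `<=` B]).

(* The order-independent sum, as the limit of the net of finite partial sums;
   it exists whenever g is absolutely summable on X. *)
Definition usum (R : realType) (T : choiceType) (X : set T) (g : T -> R[i])
    : R[i] :=
  lim ((fun Y : set T => \sum_(x \in Y) g x) @ fsets_filter X).

Notation vertex := {n : nat | (0 < n)%N}.

Definition v1 : vertex := exist _ 1%N isT.

Notation edge := {e : {fset vertex} | #|` e|%fset == 2%N}.

Definition weight (R : realType) := edge -> R[i].

(* h({u, v}) for u <> v; for u = v, where {u, v} is not an edge, it is 0. *)
Definition edge_weight (R : realType) (h : weight R) (u v : vertex) : R[i] :=
  oapp h 0 (insub [fset u; v]%fset).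

(* The default value v1 of nth is never reached: every index used below is
   smaller than the size of the sequence. *)
Definition walk (n : nat) : set (seq vertex) :=
  [set w | size w = n.+1 /\
     forall i, (i < n)%N -> nth v1 w i <> nth v1 w i.+1].

Definition walk_weight (R : realType) (h : weight R) (w : seq vertex) : R[i] :=
  \prod_(i < (size w).-1) edge_weight h (nth v1 w i) (nth v1 w i.+1).

Definition W (n : nat) : set (seq vertex) :=
  [set w | walk n w /\ nth v1 w 0 = v1].

Definition W1 (n : nat) : set (seq vertex) :=
  [set w | W n w /\ exists2 i, (1 <= i <= n)%N & nth v1 w i = v1].

Definition Wb (n : nat) : set (seq vertex) :=
  [set w | W n w /\ nth v1 w n = v1].

Definition Wc (n : nat) : set (seq vertex) :=
  [set w | [/\ (0 < n)%N, Wb n w &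
     forall i, (0 < i < n)%N -> nth v1 w i <> v1]].

Definition light (R : realType) (h : weight R) : Prop :=
  forall n, abs_summable (W n) (walk_weight h).

Definition support (R : realType) (h : weight R) : set vertex :=
  [set u | exists n, exists w,
     [/\ W n w, nth v1 w n = u & walk_weight h w <> 0]].

(* For light h and u in support h the series is absolutely summable. *)
Definition convex (R : realType) (h : weight R) : Prop :=
  forall u, support h u -> usum [set v | v <> u] (edge_weight h u) = 1.

Definition acoef (R : realType) (h : weight R) (n : nat) : R[i] :=
  usum (W1 n) (walk_weight h).

(* Formal power series are represented by their coefficient sequences. *)
Definition Bseries (R : realType) (h : weight R) (n : nat) : R[i] :=
  usum (Wb n) (walk_weight h).

Definition Cseries (R : realType) (h : weight R) (n : nat) : R[i] :=
  usum (Wc n) (walk_weight h).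

Definition partial_sums (R : realType) (u : nat -> R[i]) (n : nat) : R[i] :=
  \sum_(0 <= j < n.+1) u j.

Definition value1_exists (R : realType) (u : nat -> R[i]) : Prop :=
  cvg (partial_sums u @ \oo).

Definition value1 (R : realType) (u : nat -> R[i]) : R[i] :=
  lim (partial_sums u @ \oo).

(* Main.v *)
(** The total weight of the walks of length n is 1 by convexity, so cutting a walk
    at its first return to 1 gives a_n = c_1 + ... + c_n; the same cut gives the
    renewal equation b_n = [n = 0] + (c * b)_n. It remains to see that
    B(1) = 1 + B(1) C(1). The Cauchy product of b and c need not converge to
    B(1) C(1) on general grounds, but its partial sums have Cesaro means tending to
    B(1) C(1), and by the renewal equation these means also tend to B(1) - 1. *)

Require Import Defs.
From mathcomp Require Import all_boot all_order all_algebra complex finmap ring lra.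
From mathcomp Require Import all_classical all_reals all_analysis.

Import Order.TTheory GRing.Theory Num.Theory.
Import numFieldNormedType.Exports.
Local Open Scope classical_set_scope.
Local Open Scope ring_scope.

Set Implicit Arguments.
Unset Strict Implicit.
Unset Printing Implicit Defensive.

(** * Unordered sums over arbitrary index sets *)

(* [s] is the limit of the partial sums along the finite subsets of [X], as for
   [usum], but stated without a topology on [K]. *)
Definition has_usum (K : numFieldType) (T : choiceType) (X : set T) (g : T -> K)
    (s : K) : Prop :=
  forall e, 0 < e -> exists A : {fset T}, [set` A] `<=` X /\
    forall B : {fset T}, (A `<=` B)%fset -> [set` B] `<=` X ->
      `|\sum_(x <- B) g x - s| < e.

Lemma has_usum_unique (K : numFieldType) (T : choiceType) (X : set T)
    (g : T -> K) (s t : K) :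
  has_usum X g s -> has_usum X g t -> s = t.
Proof.
move=> hs ht; apply/eqP; rewrite -subr_eq0 -normr_eq0; apply/negP => /negP n0.
have e0 : 0 < `|s - t| / 2 by rewrite divr_gt0 // lt_neqAle eq_sym n0 normr_ge0.
have [A [AX hA]] := hs _ e0; have [B [BX hB]] := ht _ e0.
have UX : [set` (A `|` B)%fset] `<=` X.
  by move=> x /=; rewrite inE => /orP[/AX|/BX].
have {}hA := hA _ (fsubsetUl A B) UX; have {}hB := hB _ (fsubsetUr A B) UX.
have := ltrD hA hB; rewrite -splitr distrC.
move=> /(le_lt_trans (ler_distD (\sum_(x <- (A `|` B)%fset) g x) s t)).
by rewrite ltxx.
Qed.

Lemma has_usum_fset (K : numFieldType) (T : choiceType) (A : {fset T})
    (g : T -> K) :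
  has_usum [set` A] g (\sum_(x <- A) g x).
Proof.
move=> e e0; exists A; split=> // B AB BA.
suff -> : B = A by rewrite subrr normr0.
by apply/eqP; rewrite eqEfsubset AB andbT; apply/fsubsetP => x; exact: BA.
Qed.

Lemma has_usum1 (K : numFieldType) (T : choiceType) (a : T) (g : T -> K) :
  has_usum [set a] g (g a).
Proof.
have := has_usum_fset [fset a]%fset g.
by rewrite big_seq_fset1; congr has_usum; apply/seteqP; split=> x /=;
  rewrite inE => /eqP.
Qed.

Lemma eq_has_usum (K : numFieldType) (T : choiceType) (X : set T)
    (f g : T -> K) (s : K) :
  (forall x, X x -> f x = g x) -> has_usum X f s -> has_usum X g s.
Proof.
move=> fg hf e e0; have [A [AX hA]] := hf _ e0; exists A; split=> // B AB BX.
rewrite big_seq (eq_bigr f) -?big_seq; first exact: hA.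
by move=> x xB; rewrite fg //; exact: BX.
Qed.

Lemma has_usum0 (K : numFieldType) (T : choiceType) (X : set T) (g : T -> K) :
  (forall x, X x -> g x = 0) -> has_usum X g 0.
Proof.
move=> g0 e e0; exists fset0; split=> // B _ BX.
by rewrite big_seq big1 ?subrr ?normr0 // => x xB; exact/g0/BX.
Qed.

Lemma has_usumMl (K : numFieldType) (T : choiceType) (X : set T) (c : K)
    (g : T -> K) (s : K) :
  has_usum X g s -> has_usum X (fun x => c * g x) (c * s).
Proof.
have [->|c0] := eqVneq c 0.
  by move=> _; rewrite mul0r; apply: has_usum0 => x _; rewrite mul0r.
move=> h e e0; have [|A [AX hA]] := h (e / `|c|).
  by rewrite divr_gt0 // normr_gt0.
exists A; split=> // B AB BX; rewrite -mulr_sumr -mulrBr normrM mulrC.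
by rewrite -ltr_pdivlMr ?normr_gt0 //; exact: hA.
Qed.

Lemma has_usumD (K : numFieldType) (T : choiceType) (X : set T)
    (f g : T -> K) (s t : K) :
  has_usum X f s -> has_usum X g t -> has_usum X (fun x => f x + g x) (s + t).
Proof.
move=> hs ht e e0.
have e20 : 0 < e / 2 by rewrite divr_gt0.
have [A [AX hA]] := hs _ e20; have [B [BX hB]] := ht _ e20.
exists (A `|` B)%fset; split.
  by move=> x /=; rewrite inE => /orP[/AX|/BX].
move=> C; rewrite fsubUset => /andP[AC BC] CX.
rewrite big_split /= opprD addrACA (splitr e).
by apply: le_lt_trans (ler_normD _ _) _; apply: ltrD; [exact: hA|exact: hB].
Qed.

(** Once [J1] contains the image of a good finite set [A], enlarge [A] by finite sets [D i] that
    nearly exhaust the fibres over [J1]. The sum over the enlarged set is close to [S] and, grouped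
    by fibres, close to the sum of the [s i]. *)
Lemma has_usum_fibers (K : numFieldType) (T I : choiceType) (p : T -> I)
    (X : set T) (J : set I) (g : T -> K) (s : I -> K) (S : K) :
  (forall x, X x -> J (p x)) ->
  (forall i, J i -> has_usum [set x | X x /\ p x = i] g (s i)) ->
  has_usum X g S -> has_usum J s S.
Proof.
move=> pJ hfib hX e e0.
have e20 : 0 < e / 2 by rewrite divr_gt0.
have [A [AX hA]] := hX _ e20.
exists [fset p x | x in A]%fset; split.
  by move=> i /= /imfsetP[x /= xA ->]; exact/pJ/AX.
move=> J1 AJ J1J.
(* The tolerance e/2 is shared among the fibres over [J1]; the successor keeps the denominator
   nonzero when [J1] is empty. *)
pose d := e / 2 / (size J1).+1%:R.
have d0 : 0 < d by rewrite divr_gt0 // ltr0n.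
have /choice[D hD] : forall i, exists D : {fset T}, J i ->
    [set` D] `<=` [set x | X x /\ p x = i] /\
    forall B : {fset T}, (D `<=` B)%fset ->
      [set` B] `<=` [set x | X x /\ p x = i] -> `|\sum_(x <- B) g x - s i| < d.
  move=> i; have [Ji|nJi] := pselect (J i); last by exists fset0.
  by have [D hD] := hfib i Ji d d0; exists D.
pose B := (A `|` \bigcup_(i <- J1) D i)%fset.
have BX : [set` B] `<=` X.
  move=> x /=; rewrite inE => /orP[/AX//|/bigfcupP[i /andP[iJ _] xD]].
  by have [/(_ _ xD)[]] := hD i (J1J _ iJ).
have pB x : x \in B -> p x \in J1.
  rewrite inE => /orP[xA|/bigfcupP[i /andP[iJ _] xD]].
    by apply: (fsubsetP AJ); apply/imfsetP; exists x.
  by have [/(_ _ xD)[_ ->]] := hD i (J1J _ iJ).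
have AB : (A `<=` B)%fset by exact: fsubsetUl.
have DB i x : i \in J1 -> x \in D i -> x \in B.
  move=> iJ xD; rewrite inE; apply/orP; right.
  by apply/bigfcupP; exists i => //; rewrite iJ.
clearbody B.
have sumB : \sum_(x <- B) g x = \sum_(i <- J1) \sum_(x <- B | p x == i) g x.
  rewrite (exchange_big_dep xpredT) //= big_seq [RHS]big_seq.
  apply: eq_bigr => x xB; rewrite (eq_bigl (pred1 (p x))); last first.
    by move=> i; rewrite /= eq_sym.
  by rewrite -big_filter filter_pred1_uniq ?fset_uniq ?pB // big_seq1.
have hBi i : i \in J1 -> `|s i - \sum_(x <- B | p x == i) g x| <= d.
  move=> iJ; have [Di /(_ [fset x in B | p x == i]%fset) hDi] := hD i (J1J _ iJ).
  rewrite distrC big_fset_condE /=; apply/ltW/hDi.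
    apply/fsubsetP => x xD; have [_ pxi] := Di x xD.
    by rewrite !inE /= pxi eqxx andbT; exact: DB xD.
  by move=> x /=; rewrite !inE => /andP[xB /eqP pxi]; split=> //; apply: BX.
have -> : \sum_(i <- J1) s i - S
    = \sum_(i <- J1) (s i - \sum_(x <- B | p x == i) g x) + (\sum_(x <- B) g x - S).
  by rewrite sumrB -sumB addrA subrK.
rewrite (splitr e); apply: le_lt_trans (ler_normD _ _) _.
apply: ler_ltD; last exact: hA.
apply: le_trans (ler_norm_sum _ _ _) _.
apply: (@le_trans _ _ (\sum_(i <- J1) d)).
  by rewrite big_seq [leRHS]big_seq; apply: ler_sum.
rewrite big_const_seq count_predT iter_addr_0 -[d *+ _]mulr_natr.
rewrite -[leRHS](@divfK _ (size J1).+1%:R) ?pnatr_eq0 //.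
by rewrite (ler_wpM2l (ltW d0)) // ler_nat.
Qed.

(** Reindexing is regrouping with singleton fibres. *)
Lemma has_usum_bij (K : numFieldType) (T I : choiceType) (p : T -> I)
    (q : I -> T) (X : set T) (J : set I) (g : T -> K) (S : K) :
  (forall x, X x -> J (p x) /\ q (p x) = x) ->
  (forall i, J i -> X (q i) /\ p (q i) = i) ->
  has_usum X g S -> has_usum J (g \o q) S.
Proof.
move=> hp hq; apply: (@has_usum_fibers _ _ _ p) => [x /hp[]//|i Ji].
rewrite [X in has_usum X](_ : _ = [set q i]); first exact: has_usum1.
apply/seteqP; split=> x /=; first by move=> [Xx <-]; have [_ ->] := hp x Xx.
by move=> ->; exact: hq.
Qed.

Lemma ler_sum_fsubset (K : numFieldType) (T : choiceType) (A B : {fset T})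
    (f : T -> K) :
  (forall x, 0 <= f x) -> (A `<=` B)%fset ->
  \sum_(x <- A) f x <= \sum_(x <- B) f x.
Proof.
move=> f0 AB; rewrite [leRHS](bigID (mem A)) /= [X in _ <= X + _]big_fset_condE /=.
rewrite (_ : [fset i | i in B & i \in A]%fset = A).
  by rewrite lerDl sumr_ge0.
apply/fsetP => x; rewrite !inE /= andbC; case xA : (x \in A) => //=.
exact: (fsubsetP AB).
Qed.

(** The finite partial sums grow with the set, so they converge to their supremum. *)
Lemma has_usum_ge0_exists (R : realType) (T : choiceType) (X : set T)
    (f : T -> R) (M : R) :
  (forall x, 0 <= f x) ->
  (forall A : {fset T}, [set` A] `<=` X -> \sum_(x <- A) f x <= M) ->
  exists s, has_usum X f s.
Proof.
move=> f0 fM.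
pose E := [set \sum_(x <- A) f x | A in [set A : {fset T} | [set` A] `<=` X]].
have supE : has_sup E.
  split; first by exists (\sum_(x <- fset0) f x), fset0.
  by exists M => _ [A AX <-]; exact: fM.
exists (sup E) => e e0.
have [_ [A AX <-] ltA] := sup_adherent e0 supE.
exists A; split=> // B AB BX; rewrite distrC ger0_norm.
  rewrite ltrBlDr -ltrBlDl; apply: lt_le_trans ltA _.
  exact: ler_sum_fsubset.
by rewrite subr_ge0; apply: ub_le_sup; [exact: supE.2|exists B].
Qed.

(** * Absolutely summable complex families *)

Local Open Scope complex_scope.

Lemma has_usum_real_complex (R : realType) (T : choiceType) (X : set T)
    (f : T -> R) (s : R) :
  has_usum X f s -> has_usum X (fun x => (f x)%:C) s%:C.
Proof.
move=> h e e0; have eR : e = (complex.Re e)%:C by rewrite RRe_real ?gtr0_real.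
rewrite eR in e0 *; rewrite ltcR in e0.
have [A [AX hA]] := h _ e0; exists A; split=> // B AB BX.
rewrite -rmorph_sum -rmorphB normc_def /= expr0n /= addr0 sqrtr_sqr ltcR.
exact: hA.
Qed.

Lemma abs_summable_fset (R : realType) (T : choiceType) (X : set T)
    (g : T -> R[i]) :
  abs_summable X g <-> exists M : R, forall A : {fset T}, [set` A] `<=` X ->
    \sum_(x <- A) `|g x| <= M%:C.
Proof.
split=> -[M hM]; exists M => A.
  move=> AX; rewrite fsbig_seq ?fset_uniq //; apply: hM.
  by split=> //; exact: finite_fset.
move=> [fA AX]; rewrite fsbig_finite //; apply: hM => x /=.
by rewrite in_fset_set // inE; exact: AX.
Qed.

(** Real and imaginary parts become nonnegative once the modulus is added; with the modulus itself
    this gives three bounded nonnegative families, each of which has a sum. *)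
Lemma abs_summable_has_usum (R : realType) (T : choiceType) (X : set T)
    (g : T -> R[i]) :
  abs_summable X g -> exists s, has_usum X g s.
Proof.
move=> /abs_summable_fset[M hM].
pose n x := complex.Re `|g x|.
have nE x : `|g x| = (n x)%:C by rewrite RRe_real ?normr_real.
have hn (A : {fset T}) : [set` A] `<=` X -> \sum_(x <- A) n x <= M.
  move=> /hM; under eq_bigr do rewrite nE.
  by rewrite -rmorph_sum lecR.
have n0 x : 0 <= n x by rewrite -ler0c -nE.
have part (f : R[i] -> R) : (forall z, `|f z|%:C <= `|z|) ->
    exists s, has_usum X (fun x => f (g x) + n x) s.
  move=> fz.
  have fn x : `|f (g x)| <= n x by rewrite -lecR -nE.
  apply: (@has_usum_ge0_exists _ _ _ _ (M + M)) => [x|A AX].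
    by rewrite -lerBlDr sub0r; have := fn x; rewrite ler_norml => /andP[].
  rewrite big_split lerD // ?hn //; apply: le_trans (hn A AX).
  by apply: ler_sum => x _; apply: le_trans (fn x); exact: ler_norm.
have [r hr] := part _ (@normc_ge_Re R).
have [|t ht] := part (@complex.Im R).
  (* Since Im z = - Re (iz), the bound for Re carries over to Im. *)
  move=> z; have := normc_ge_Re (z * 'i); rewrite ReiNIm normrN normrM.
  by rewrite [X in _ * X]normc_def /= expr0n expr1n add0r sqrtr1 mulr1.
have [u hu] := has_usum_ge0_exists n0 hn.
(* With n = |g|, g = (Re g + n) + i (Im g + n) - (1 + i) n. *)
exists (r%:C + ('i%C * t%:C + (- (1 + 'i%C)) * u%:C)).
have := has_usumD (has_usum_real_complex hr) (has_usumD
  (has_usumMl 'i%C (has_usum_real_complex ht))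
  (has_usumMl (- (1 + 'i%C)) (has_usum_real_complex hu))).
by apply: eq_has_usum => x _; rewrite [RHS]complexE !rmorphD /=; ring.
Qed.

Lemma sub_abs_summable (R : realType) (T : choiceType) (X Y : set T)
    (g : T -> R[i]) :
  Y `<=` X -> abs_summable X g -> abs_summable Y g.
Proof.
by move=> YX [M hM]; exists M => A [fA AY]; apply: hM; split=> // x /AY /YX.
Qed.

(** The finite subsets of [X] generate a proper filter and the norm topology is Hausdorff, so the
    limit defining [usum] is unique. *)
Lemma has_usum_usum (R : realType) (T : choiceType) (X : set T)
    (g : T -> R[i]) (s : R[i]) :
  has_usum X g s -> usum X g = s.
Proof.
move=> hs; have FF : ProperFilter (fsets_filter X).
  apply: filter_from_proper; last by move=> A hA; exists A; split.
  apply: filter_from_filter; first by exists set0; exact: fsets_set0.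
  move=> A B [fA AX] [fB BX]; exists (A `|` B).
    by split; [rewrite finite_setU|rewrite subUset].
  by move=> C [hC]; rewrite subUset => -[AC BC]; split; split.
apply: cvg_lim; first exact: norm_hausdorff.
apply/cvgrPdist_lt => e e0; have [A [AX hA]] := hs e e0.
exists [set` A]; first by split=> //; exact: finite_fset.
move=> B [[fB BX] AB] /=; rewrite distrC fsbig_finite //; apply: hA.
  by apply/fsubsetP => x xA; rewrite in_fset_set // inE; exact: AB.
by move=> x /=; rewrite in_fset_set // inE; exact: BX.
Qed.

Lemma has_usum_seq (K : numFieldType) (T : choiceType) (r : seq T)
    (g : T -> K) :
  uniq r -> has_usum [set` r] g (\sum_(x <- r) g x).
Proof.
move=> ur; have := has_usum_fset [fset x in r]%fset g.
rewrite (perm_big r) /=; last first.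
  by apply: uniq_perm => // x; rewrite !inE.
by congr has_usum; apply/seteqP; split=> x /=; rewrite !inE.
Qed.

(** * Walks from 1 and their tails *)

(* A walk starting at 1 is represented by the sequence of its later vertices. *)
Definition tails (n : nat) : set (seq vertex) :=
  [set s | size s = n /\ path (fun u v => u != v) v1 s].

Definition tail_weight (R : realType) (h : weight R) (s : seq vertex) : R[i] :=
  walk_weight h (v1 :: s).

(** The total weight, a_n, b_n and c_n all arise from choices of [P]. Summing over walks rather than
    tails makes each identification an equality of index sets. *)
Definition tail_sum (R : realType) (h : weight R) (n : nat)
    (P : set (seq vertex)) : R[i] :=
  usum [set w | W n w /\ P (behead w)] (walk_weight h).

Lemma walk_weight_cons (R : realType) (h : weight R) (x y : vertex)
    (s : seq vertex) :
  walk_weight h [:: x, y & s] = edge_weight h x y * walk_weight h (y :: s).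
Proof. by rewrite /walk_weight /= big_ord_recl. Qed.

Lemma walk_weight1 (R : realType) (h : weight R) (x : vertex) :
  walk_weight h [:: x] = 1.
Proof. by rewrite /walk_weight big_ord0. Qed.

Lemma walk_weight_cat (R : realType) (h : weight R) (x : vertex)
    (s t : seq vertex) :
  walk_weight h (x :: s ++ t)
    = walk_weight h (x :: s) * walk_weight h (last x s :: t).
Proof.
elim: s x => [|y s IH] x /=; first by rewrite walk_weight1 mul1r.
by rewrite !walk_weight_cons IH mulrA.
Qed.

Lemma W_tails (n : nat) (w : seq vertex) :
  W n w <-> w = v1 :: behead w /\ tails n (behead w).
Proof.
split=> [[[sz hw] w0]|[-> [sz /(pathP v1) hs]]].
  case: w sz hw w0 => // x s [sz] hw /= x1.
  rewrite {x}x1 in hw *; split=> //; split=> //.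
  by apply/(pathP v1) => i; rewrite sz => /hw /eqP.
split=> //=; split; first by rewrite /= sz.
by move=> i ltin; apply/eqP; apply: hs; rewrite sz.
Qed.

Lemma has_usum_tails (R : realType) (h : weight R) (n : nat)
    (P : set (seq vertex)) :
  light h -> has_usum [set s | tails n s /\ P s] (tail_weight h) (tail_sum h n P).
Proof.
move=> hl; have [|S hS] := @abs_summable_has_usum _ _
  [set w | W n w /\ P (behead w)] (walk_weight h).
  by apply: sub_abs_summable (hl n) => w [].
rewrite /tail_sum (has_usum_usum hS).
apply: (has_usum_bij (p := behead) (q := cons v1)) hS
  => [w [/W_tails[<- ?] ?]//|s [ts Ps]].
by split=> //; split=> //; apply/W_tails.
Qed.

Lemma acoef_tail_sum (R : realType) (h : weight R) (n : nat) :
  acoef h n = tail_sum h n [set s : seq vertex | v1 \in s].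
Proof.
congr usum; apply/seteqP; split=> w [Ww].
  move=> [[|i] // /andP[_ lin]]; have /W_tails[wE [sz _]] := Ww.
  move=> wi; split=> //=.
  by rewrite wE /= in wi; rewrite -[X in X \in _]wi mem_nth // sz.
move=> /= /(nthP v1)[i lti wi]; split=> //.
have /W_tails[wE [sz _]] := Ww.
by exists i.+1; [rewrite -sz|rewrite wE].
Qed.

(** The default [v1] of [last] is the starting vertex, so the walk of length 0 counts as closed. *)
Lemma Bseries_tail_sum (R : realType) (h : weight R) (n : nat) :
  Bseries h n = tail_sum h n [set s : seq vertex | last v1 s = v1].
Proof.
congr usum; apply/seteqP; split=> w [Ww hw]; split=> //; move: hw => /=;
  have /W_tails[-> [<- _]] := Ww; by rewrite -[size _]/(size (v1 :: _)).-1 nth_last.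
Qed.

(** The condition puts the first occurrence of [v1] at the end of the tail. It fails if [v1] is
    absent, since [index] then equals the size; this excludes the empty tail, in accordance with
    [Wc 0] being empty. *)
Lemma Cseries_tail_sum (R : realType) (h : weight R) (n : nat) :
  Cseries h n = tail_sum h n [set s : seq vertex | (index v1 s).+1 = size s].
Proof.
congr usum; apply/seteqP; split=> w.
  move=> [n0 [Ww wn] hw]; split=> //=; have /W_tails[wE [sz _]] := Ww.
  rewrite wE in wn hw; move: (behead w) sz wn hw => s sz wn hw.
  have lt_index : (index v1 s < n)%N.
    by rewrite -sz index_mem -wn -(prednK n0) /= mem_nth // sz prednK.
  apply/eqP; rewrite eqn_leq sz lt_index /= leqNgt; apply/negP => lt1.
  apply: (hw (index v1 s).+1) => //=.
  by rewrite nth_index // -index_mem sz.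
move=> [Ww /= hi]; have /W_tails[wE [sz _]] := Ww.
have n0 : (0 < n)%N by rewrite -sz -hi.
split=> //.
  split=> //; rewrite wE -sz -hi /= nth_index // -index_mem -hi //.
move=> [//|i] /= ltin; rewrite wE /=; apply/eqP/negbT.
apply: (@before_find _ v1 (pred1 v1)).
by rewrite -ltnS [X in (_ < X)%N]hi sz.
Qed.

(** * First returns and convexity *)

(** Cut a tail right after its first [v1]: the first piece [u] is a first-return walk, the rest is
    again the tail of a walk from 1, and weights multiply. *)
Lemma first_return (R : realType) (h : weight R) (n : nat)
    (Z : set (seq vertex)) :
  light h ->
  tail_sum h n [set s : seq vertex | v1 \in s /\ Z (drop (index v1 s).+1 s)]
    = \sum_(0 <= k < n.+1) Cseries h k * tail_sum h (n - k) Z.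
Proof.
move=> hl.
have hS := has_usum_tails n
  [set s : seq vertex | v1 \in s /\ Z (drop (index v1 s).+1 s)] hl.
pose J := [set u : seq vertex |
  [/\ (size u <= n)%N, tails (size u) u & (index v1 u).+1 = size u]].
have lastJ u : J u -> last v1 u = v1.
  by move=> [_ _ su]; rewrite (last_nth v1) -su /= nth_index // -index_mem -su.
(* Regroup by the first piece: on the fibre over [u] the factor [tail_weight h u] is constant, and
   dropping [u] is a bijection onto the admissible remainders. *)
have {hS}hJ : has_usum J (fun u => tail_weight h u * tail_sum h (n - size u) Z)
    (tail_sum h n [set s : seq vertex | v1 \in s /\ Z (drop (index v1 s).+1 s)]).
  apply: (has_usum_fibers (p := fun s => take (index v1 s).+1 s)) hS => [s|u Ju].
    move=> [[sz ps] [v1s _]].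
    have szt : size (take (index v1 s).+1 s) = (index v1 s).+1.
      by rewrite size_takel // index_mem.
    split; rewrite ?szt; first by rewrite -sz index_mem.
      split=> //; move: ps; rewrite -{1}(cat_take_drop (index v1 s).+1 s).
      by rewrite cat_path => /andP[].
    have v1t : v1 \in take (index v1 s).+1 s.
      rewrite -[X in X \in _](nth_index v1 v1s) -(@nth_take (index v1 s).+1) //.
      by rewrite mem_nth // szt.
    have := index_cat v1 (take (index v1 s).+1 s) (drop (index v1 s).+1 s).
    by rewrite v1t cat_take_drop => <-.
  have [szu [_ pu] iu] := Ju; have lu := lastJ u Ju.
  have v1u : v1 \in u by rewrite -index_mem -iu.
  have hu := has_usumMl (tail_weight h u) (has_usum_tails (n - size u) Z hl).
  apply: (@eq_has_usum _ _ _ ((fun t => tail_weight h u * tail_weight h t)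
    \o drop (size u))) => [s [[_ [v1s _]] su] /=|].
    have szi : (index v1 s).+1 = size u by rewrite -su size_takel // index_mem.
    rewrite -szi /tail_weight -[in RHS](cat_take_drop (index v1 s).+1 s).
    by rewrite walk_weight_cat su lu.
  apply: (has_usum_bij (p := cat u)) hu.
  - move=> t [[szt pt] Zt]; rewrite drop_size_cat //; split=> //=.
    have it : index v1 (u ++ t) = index v1 u by rewrite index_cat v1u.
    rewrite it iu drop_size_cat // take_size_cat //; split=> //; split.
      by split; [rewrite size_cat szt subnKC|rewrite cat_path pu lu].
    by rewrite mem_cat v1u.
  - move=> s [[[sz ps] [v1s Zs]] su].
    have szi : (index v1 s).+1 = size u.
      by rewrite -su size_takel // index_mem.
    have sE : u ++ drop (size u) s = s.
      by rewrite -szi -[X in X ++ _]su cat_take_drop.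
    split=> //; split; last by rewrite -szi.
    split; first by rewrite size_drop sz.
    by move: ps; rewrite -sE cat_path lu drop_size_cat // => /andP[].
(* Regroup by the length [k] of the first piece: the sum over remainders depends on [k] alone and
   factors out. *)
have hK : has_usum [set` index_iota 0 n.+1]
    (fun k => Cseries h k * tail_sum h (n - k) Z)
    (tail_sum h n [set s : seq vertex | v1 \in s /\ Z (drop (index v1 s).+1 s)]).
  apply: (has_usum_fibers (p := size)) hJ => [u [szu _ _]|k].
    by rewrite /= mem_index_iota.
  rewrite /= mem_index_iota /= ltnS => lekn.
  rewrite Cseries_tail_sum mulrC.
  rewrite [X in has_usum X](_ : _ = [set s | tails k s /\ (index v1 s).+1 = size s]).
    have := has_usumMl (tail_sum h (n - k) Z)
      (has_usum_tails k [set s : seq vertex | (index v1 s).+1 = size s] hl).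
    by apply: eq_has_usum => s [[-> _] _]; rewrite mulrC.
  apply/seteqP; split=> u /=; first by move=> [[? ? ?] <-].
  by move=> [[szu pu] iu]; split=> //; split=> //; rewrite szu.
exact: has_usum_unique hK (has_usum_seq _ (iota_uniq _ _)).
Qed.

(** Induction on the length, erasing the last vertex: by convexity the possible last steps after [u]
    have total weight 1, so the fibre over [u] sums to the weight of [u]. *)
Lemma convex_tail_sum (R : realType) (h : weight R) (n : nat) :
  light h -> convex h -> tail_sum h n setT = 1.
Proof.
move=> hl hc; elim: n => [|n IH].
  have := has_usum_tails 0 setT hl.
  rewrite [X in has_usum X](_ : _ = [set [::]]).
    move=> /has_usum_unique; apply; have := has_usum1 [::] (tail_weight h).
    by rewrite /tail_weight walk_weight1.
  by apply/seteqP; split=> s /=; [move=> [[/size0nil]]|move->].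
rewrite -[RHS]IH; apply: has_usum_unique (has_usum_tails n setT hl).
have := has_usum_tails n.+1 setT hl.
apply: (has_usum_fibers (p := take n)) => [s [[sz ps] _]|u [[szu pu] _]].
  split=> //; split; first by rewrite size_takel // sz.
  by move: ps; rewrite -{1}(cat_take_drop n s) cat_path => /andP[].
have take_rcons v : take n (rcons u v) = u by rewrite -cats1 take_size_cat.
have rconsE s : size s = n.+1 -> take n s = u -> rcons u (last v1 s) = s.
  case/lastP: s => // s v; rewrite size_rcons => -[<-].
  by rewrite -cats1 take_size_cat // last_cat cats1 => ->.
have weight_rcons v :
    tail_weight h (rcons u v) = tail_weight h u * edge_weight h (last v1 u) v.
  by rewrite /tail_weight -cats1 walk_weight_cat walk_weight_cons walk_weight1 mulr1.
(* Convexity speaks only of vertices in [support h]. The endpoint of [u] may lie outside when [u]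
   has weight 0, but then every extension of [u] has weight 0 too. *)
have [u0|/eqP u0] := eqVneq (tail_weight h u) 0.
  rewrite u0; apply: has_usum0 => s [[[sz _] _] su].
  by rewrite -(rconsE s) // weight_rcons u0 mul0r.
have hu := has_usum_tails n.+1 [set s | take n s = u] hl.
rewrite [X in has_usum X](_ : _ =
  [set s | tails n.+1 s /\ take n s = u]); last first.
  by apply/seteqP; split=> s /=; [move=> [[]]|move=> []].
suff <- : tail_sum h n.+1 [set s | take n s = u] = tail_weight h u by [].
(* Dividing by the nonzero weight of [u] turns the sum over its extensions into the sum of the edge
   weights at its endpoint. *)
have hv : has_usum [set v | v <> last v1 u] (edge_weight h (last v1 u))
    ((tail_weight h u)^-1 * tail_sum h n.+1 [set s | take n s = u]).
  apply: (@eq_has_usum _ _ _ ((fun s => (tail_weight h u)^-1 * tail_weight h s)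
    \o rcons u)) => [v _ /=|]; first by rewrite weight_rcons mulKf //; apply/eqP.
  apply: (has_usum_bij (p := last v1)) (has_usumMl _ hu).
  - move=> s [[sz ps] su]; have sE := rconsE s sz su; split=> //=.
    move: ps; rewrite -sE last_rcons rcons_path => /andP[_ /eqP neq] E.
    exact: neq.
  - move=> v /= /eqP neq; rewrite last_rcons; split=> //; split=> //; split.
      by rewrite size_rcons szu.
    by rewrite rcons_path pu eq_sym.
have := hc (last v1 u); rewrite (has_usum_usum hv) => hE.
rewrite -[LHS](mulVKf (x := tail_weight h u)); last exact/eqP.
rewrite hE ?mulr1 //; exists n, (v1 :: u); split=> //; first exact/W_tails.
by rewrite -szu -[size u]/(size (v1 :: u)).-1 nth_last.
Qed.

(** Nothing is required after the first return, so the remainders contribute the factor 1. *)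
Lemma acoef_partial_sums (R : realType) (h : weight R) (n : nat) :
  light h -> convex h -> acoef h n = partial_sums (Cseries h) n.
Proof.
move=> hl hc; rewrite acoef_tail_sum.
rewrite [X in tail_sum h n X](_ : _ =
  [set s : seq vertex | v1 \in s /\ setT (drop (index v1 s).+1 s)]); last first.
  by apply/seteqP; split=> s /=; [|case].
rewrite first_return //; apply: eq_bigr => k _.
by rewrite convex_tail_sum // mulr1.
Qed.

(** A closed walk of positive length returns to 1, and what follows its first return is again
    closed; the term [n = 0] is the trivial walk, which has no return. *)
Lemma Bseries_renewal (R : realType) (h : weight R) (n : nat) :
  light h ->
  Bseries h n = (n == 0)%:R + \sum_(0 <= k < n.+1) Cseries h k * Bseries h (n - k).
Proof.
move=> hl; under eq_bigr do rewrite Bseries_tail_sum.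
rewrite Bseries_tail_sum -first_return //; case: n => [|n].
  rewrite (has_usum_unique (has_usum_tails 0 _ hl) (t := 1)).
    rewrite (has_usum_unique (has_usum_tails 0 _ hl) (t := 0)) ?addr0 //.
    by apply: has_usum0 => s [[/size0nil -> _] /= []].
  rewrite [X in has_usum X](_ : _ = [set [::]]).
    by have := has_usum1 [::] (tail_weight h); rewrite /tail_weight walk_weight1.
  by apply/seteqP; split=> s /=; [move=> [[/size0nil]]|move->].
rewrite add0r; apply: (has_usum_unique (has_usum_tails n.+1 _ hl)).
have := has_usum_tails n.+1
  [set s : seq vertex | v1 \in s /\ last v1 (drop (index v1 s).+1 s) = v1] hl.
congr has_usum; apply/seteqP; split=> s [[sz ps]] /=.
  move=> [v1s ls]; split=> //.
  rewrite -(cat_take_drop (index v1 s).+1 s) last_cat -[RHS]ls; congr last.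
  by rewrite (take_nth v1) ?index_mem // last_rcons nth_index.
move=> ls; have v1s : v1 \in s.
  by case: s sz ls {ps} => // x s _ /= ls; rewrite -[X in X \in _]ls mem_last.
split=> //; split=> //.
rewrite -(cat_take_drop (index v1 s).+1 s) last_cat in ls.
by rewrite (take_nth v1) ?index_mem // last_rcons nth_index in ls.
Qed.

(** * Cauchy products and Cesaro means *)

(** Serves twice in [renewal_value]: the first summation turns b into its partial sums, the second
    does the same to c, leaving a convolution of partial sums. *)
Lemma sum_conv (K : nzSemiRingType) (f g : nat -> K) (n : nat) :
  \sum_(0 <= m < n.+1) \sum_(0 <= k < m.+1) f k * g (m - k)%N
    = \sum_(0 <= k < n.+1) f k * \sum_(0 <= j < (n - k).+1) g j.
Proof.
elim: n => [|n IH]; first by rewrite !big_nat1 subnn ?big_nat1.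
rewrite big_nat_recr //= IH [RHS]big_nat_recr //= subnn big_nat1.
rewrite [X in _ + X]big_nat_recr //= subnn addrA -big_split /=.
congr (_ + _); rewrite big_nat [RHS]big_nat; apply: eq_bigr => k /= ltkn.
by rewrite -mulrDr subSn // [in RHS]big_nat_recr.
Qed.

Lemma convC (K : comNzSemiRingType) (f g : nat -> K) (n : nat) :
  \sum_(0 <= k < n.+1) f k * g (n - k)%N
    = \sum_(0 <= k < n.+1) g k * f (n - k)%N.
Proof.
rewrite big_nat_rev /= big_nat [RHS]big_nat; apply: eq_bigr => k /= ltkn.
by rewrite add0n subSS subKn // mulrC.
Qed.

(** Norms in [R[i]] lie in [R[i]]; taking real parts gives a real sequence, as [mean_bound_le0]
    requires. *)
Lemma cvg_norm_dist (R : realType) (u : nat -> R[i]) (l : R[i]) :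
  u @ \oo --> l -> (complex.Re `|l - u n|) @[n --> \oo] --> (0 : R).
Proof.
move=> /cvgrPdist_lt ul; apply/cvgrPdist_lt => e e0.
have [|N _ hN] := ul e%:C; first by rewrite ltcR.
exists N => // n /hN; rewrite sub0r normrN [X in _ -> X < _]ger0_norm.
  by rewrite -ltcR RRe_real ?normr_real.
by rewrite -ler0c RRe_real ?normr_real.
Qed.

(** The means of [e] tend to 0 by Cesaro, and each is at least [d]. *)
Lemma mean_bound_le0 (R : realType) (d : R) (e : nat -> R) :
  e @ \oo --> 0 ->
  (forall n, n.+1%:R * d <= \sum_(0 <= k < n.+1) e k) -> d <= 0.
Proof.
move=> /cesaro ce hd; rewrite -(cvg_lim (@Rhausdorff R) ce).
apply: limr_ge; first by apply/cvg_ex; exists 0.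
apply: nearW => n; rewrite /arithmetic_mean /= ler_pdivlMl ?ltr0n //.
Qed.

(** Summing the renewal equation twice expresses (n + 1)(B - 1 - BC) through the errors of the
    partial sums. Its norm is at most the sum of the first n + 1 terms of a null sequence, so
    [mean_bound_le0] applies. *)
Lemma renewal_value (R : realType) (b c : nat -> R[i]) (B C : R[i]) :
  (forall n, b n = (n == 0)%:R + \sum_(0 <= k < n.+1) c k * b (n - k)%N) ->
  partial_sums b @ \oo --> B -> partial_sums c @ \oo --> C ->
  B = 1 + B * C.
Proof.
move=> hb cB cC.
have sumb n : partial_sums b n
    = 1 + \sum_(0 <= k < n.+1) partial_sums b k * c (n - k)%N.
  rewrite {1}/partial_sums; under eq_bigr do rewrite hb.
  rewrite big_split /= sum_conv -convC; congr (_ + _).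
  by rewrite big_nat_recl //= big1 ?addr0.
have meanb n : \sum_(0 <= m < n.+1) partial_sums b m = n.+1%:R
    + \sum_(0 <= k < n.+1) partial_sums b k * partial_sums c (n - k)%N.
  under eq_bigr do rewrite sumb.
  by rewrite big_split /= sum_conv sumr_const_nat subn0.
pose x n := complex.Re `|B - partial_sums b n|.
pose y n := complex.Re `|C - partial_sums c n|.
have normE (z : R[i]) : `|z| = (complex.Re `|z|)%:C.
  by rewrite RRe_real ?normr_real.
have x0 : x @ \oo --> 0 by exact: cvg_norm_dist.
have y0 : y @ \oo --> 0 by exact: cvg_norm_dist.
(* With X and Y the errors of b at k and of c at n - k, the k-th error term is X + XY - XC - BY; [p]
   bounds the part attributed to k, [q] the part attributed to n - k. *)
pose p n := x n + x n * x n + complex.Re `|C| * x n.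
pose q n := y n * y n + complex.Re `|B| * y n.
have e0 : (fun n => p n + q n) @ \oo --> 0.
  rewrite [X in _ --> X](_ : _ = (0 + 0 * 0 + complex.Re `|C| * 0)
    + (0 * 0 + complex.Re `|B| * 0)); last by rewrite !mulr0 !addr0.
  by apply: cvgD; apply: cvgD; [apply: cvgD => //; exact: cvgM|
    exact: cvgMl_tmp|exact: cvgM|exact: cvgMl_tmp].
suff : complex.Re `|B - 1 - B * C| <= 0.
  rewrite -lecR -normE normr_le0 subr_eq0 subr_eq => /eqP {1}->.
  by rewrite addrC.
apply: (mean_bound_le0 e0) => n.
(* Reversing the sum of [q] pairs [p k] with [q (n - k)]. *)
rewrite big_split /= [X in _ <= _ + X]big_nat_rev /= -big_split /=.
rewrite -lecR rmorphM rmorph_sum /= -normE rmorph_nat.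
rewrite -[n.+1%:R]normr_nat -normrM.
have -> : n.+1%:R * (B - 1 - B * C) = \sum_(0 <= k < n.+1)
   ((B - partial_sums b k) + (partial_sums b k * partial_sums c (n - k)%N - B * C)).
  rewrite big_split /= !sumrB meanb !sumr_const_nat subn0.
  by rewrite -[B *+ _]mulr_natl -[B * C *+ _]mulr_natl; ring.
apply: le_trans (ler_norm_sum _ _ _) _; rewrite [leLHS]big_nat [leRHS]big_nat.
apply: ler_sum => k /= ltkn; rewrite add0n subSS.
(* As |X Y| <= |X|^2 + |Y|^2, no bound on the partial sums is needed. *)
set X := B - partial_sums b k.
set Y := C - partial_sums c (n - k)%N.
have -> : X + (partial_sums b k * partial_sums c (n - k)%N - B * C)
    = X + (X * Y - X * C - B * Y) by rewrite /X /Y; ring.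
have [nX nY] : `|X| = (x k)%:C /\ `|Y| = (y (n - k)%N)%:C by rewrite -!normE.
apply: le_trans (ler_normD _ _) _.
apply: le_trans (lerD (lexx _) (ler_normB _ _)) _.
apply: le_trans (lerD (lexx _) (lerD (ler_normB _ _) (lexx _))) _.
rewrite !normrM nX nY (normE C) (normE B) -!rmorphM -!rmorphD lecR.
have sqD (r s : R) : r * s <= r * r + s * s.
  have := addr_ge0 (sqr_ge0 (r - s)) (addr_ge0 (sqr_ge0 r) (sqr_ge0 s)).
  rewrite !expr2; lra.
have := sqD (x k) (y (n - k)%N); rewrite /p /q.
move: (x k) (y _) (complex.Re _) (complex.Re _) => r s t u; lra.
Qed.

Local Close Scope complex_scope.

Theorem theorem4 (R : realType) (h : weight R)
    (h_light : light h) (h_convex : convex h)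
    (B_exists : value1_exists (Bseries h))
    (C_exists : value1_exists (Cseries h)) :
  value1 (Bseries h) <> 0 /\
  (acoef h n @[n --> \oo] --> 1 - 1 / value1 (Bseries h)).
Proof.
have hBC := renewal_value (fun n => Bseries_renewal n h_light)
  B_exists C_exists.
rewrite -/(value1 _) -/(value1 (Cseries h)) in hBC.
have B0 : value1 (Bseries h) <> 0.
  by move=> B0; move: hBC; rewrite B0 mul0r addr0 => /esym/eqP; rewrite oner_eq0.
split; first exact: B0.
(* Dividing B = 1 + BC by B gives 1 - 1/B = C, the limit of the partial sums that equal a_n. *)
have -> : 1 - 1 / value1 (Bseries h) = value1 (Cseries h).
  move/eqP in B0; apply: (mulfI B0); rewrite mulrBr mulr1 mul1r mulfV //.
  by rewrite {1}hBC addrAC subrr add0r.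
have -> : acoef h = partial_sums (Cseries h).
  by apply/funext => n; exact: acoef_partial_sums.
exact: C_exists.
Qed.
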